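(* Let $\mathcal H=(V,\mathcal E)$ and $\mathcal H'=(V',\mathcal E')$ be hypergraphs with $V=\{1,\dots,n\}$ and $V'=\{1,\dots,m\}$. Then $\mathcal H\preceq\mathcal H'$ if and only if $f_{\mathcal H}\le f_{\mathcal H'}$.
   Context: A hypergraph $\mathcal H=(V,\mathcal E)$ consists of a finite nonempty set $V$ and a collection $\mathcal E$ of subsets of $V$ (hyperedges; the empty set may be a hyperedge). For $V=\{1,\dots,n\}$, $f_{\mathcal H}\colon\{0,1\}^n\to\{0,1\}$ is the function computed by the polynomial over $GF(2)$ given by $\sum_{E\in\mathcal E}\prod_{i\in E}x_i$ (empty product $=1$). A map $h'\colon V'\to V$ is a quotient map from $\mathcal H'=(V',\mathcal E')$ to $\mathcal H=(V,\mathcal E)$ if for every $E\subseteq V$: $E\in\mathcal E$ iff the number of $E'\in\mathcal E'$ with $h'(E')=E$ is odd (where $h'(E')=\{h'(i):i\in E'\}$). Write $\mathcal H\preceq\mathcal H'$ if there is a quotient map from $\mathcal H'$ to $\mathcal H$. For Boolean functions $g$ of arity $m$ and $f$ of arity $n$, $g\le f$ means there is $\sigma\colon\{1,\dots,n\}\to\{1,\dots,m\}$ with $g(a_1,\dots,a_m)=f(a_{\sigma(1)},\dots,a_{\sigma(n)})$ for all $a_i\in\{0,1\}$. *)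

(* Defs.v *)
From HB Require Import structures.
From mathcomp Require Import all_boot all_algebra.
From mathcomp Require Import mpoly.

Set Implicit Arguments.
Unset Strict Implicit.
Unset Printing Implicit Defensive.

Import GRing.Theory.
Local Open Scope ring_scope.

(* A hypergraph on the vertex set V, given by its set of hyperedges (set0 is
   allowed as a hyperedge). Nonemptiness of V is not part of the type. *)
Definition hypergraph (V : finType) : Type := {set {set V}}.

Definition quotient_map (V' V : finType) (H' : hypergraph V')
    (H : hypergraph V) (h : V' -> V) : Prop :=
  forall E : {set V},
    E \in H <-> odd #|[set E' : {set V'} in H' | h @: E' == E]|.

(* preceq H H' : H is a quotient of H'. *)
Definition preceq (V V' : finType) (H : hypergraph V) (H' : hypergraph V')
    : Prop :=
  exists h : V' -> V, quotient_map H' H h.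

(* {0,1} is the two-element field 'F_2, and the coordinates 1..n are 'I_n. *)
Definition boolfun (n : nat) : Type := {ffun 'I_n -> 'F_2} -> 'F_2.

Definition minor (m n : nat) (g : boolfun m) (f : boolfun n) : Prop :=
  exists sigma : 'I_n -> 'I_m,
    forall a : {ffun 'I_m -> 'F_2}, g a = f [ffun i => a (sigma i)].

Definition hypergraph_poly (n : nat) (H : hypergraph 'I_n) : {mpoly 'F_2[n]} :=
  \sum_(E in H) \prod_(i in E) 'X_i.

Definition hypergraph_fun (n : nat) (H : hypergraph 'I_n) : boolfun n :=
  fun x => (hypergraph_poly H).@[x].

(* Main.v *)
(** Substituting [a \o h] into the polynomial of [H'] and using idempotency of
    multiplication in ['F_2] merges the monomials of the edges with the same
    image under [h]; they survive exactly when their number is odd.  Hence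
    [f_H' (a \o h)] is the function of the quotient of [H'] by [h].  Since the
    multilinear representation of a Boolean function is unique, [h] is a
    quotient map onto [H] iff [f_H a = f_H' (a \o h)] for all [a]. *)
Require Import Defs.
From mathcomp Require Import all_boot all_algebra.
From mathcomp Require Import mpoly.

Set Implicit Arguments.
Unset Strict Implicit.
Unset Printing Implicit Defensive.

Import GRing.Theory.
Local Open Scope ring_scope.

Lemma F2_expr_gt0 (x : 'F_2) k : (0 < k)%N -> x ^+ k = x.
Proof.
case: k => // k _; elim: k => // k IHk; rewrite exprS IHk.
by case: x {IHk} => [[|[|]]] // lt; apply: val_inj.
Qed.

Lemma F2_natr_odd k : k%:R = (odd k)%:R :> 'F_2.
Proof. by apply: val_inj; rewrite /= !val_Fp_nat // !modn2 oddb. Qed.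

Lemma hypergraph_funE n (H : hypergraph 'I_n) (a : {ffun 'I_n -> 'F_2}) :
  hypergraph_fun H a = \sum_(E in H) \prod_(i in E) a i.
Proof.
rewrite /hypergraph_fun /hypergraph_poly rmorph_sum.
apply: eq_bigr => E _; rewrite rmorph_prod.
by apply: eq_bigr => i _; exact: mevalXU.
Qed.

Lemma prod_comp_imset (V V' : finType) (h : V' -> V) (a : V -> 'F_2)
    (E : {set V'}) :
  \prod_(i in E) a (h i) = \prod_(j in h @: E) a j.
Proof.
rewrite (partition_big_imset h); apply: eq_bigr => j /imsetP[i iE ->].
rewrite (eq_bigr (fun=> a (h i))) => [|k /andP[_ /eqP->] //].
by rewrite prodr_const F2_expr_gt0 //; apply/card_gt0P; exists i; apply/andP.
Qed.

Definition quotient_hypergraph (V V' : finType) (h : V' -> V)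
    (H' : hypergraph V') : hypergraph V :=
  [set E | odd #|[set E' : {set V'} in H' | h @: E' == E]|].

Lemma quotient_mapP (V V' : finType) (H : hypergraph V) (H' : hypergraph V')
    (h : V' -> V) :
  quotient_map H' H h <-> H = quotient_hypergraph h H'.
Proof.
split=> [qh | -> E]; last by rewrite inE.
by apply/setP => E; rewrite inE; apply/idP/idP => /qh.
Qed.

Lemma quotient_hypergraph_fun n m (h : 'I_m -> 'I_n) (H' : hypergraph 'I_m)
    (a : {ffun 'I_n -> 'F_2}) :
  hypergraph_fun (quotient_hypergraph h H') a
    = hypergraph_fun H' [ffun i => a (h i)].
Proof.
rewrite !hypergraph_funE big_mkcond /=.
under [RHS]eq_bigr => E' _.
  under eq_bigr => i _ do rewrite ffunE.
  rewrite prod_comp_imset; over.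
(* Edges with the same image carry the same monomial, so only the parity of their number counts in
   ['F_2]. *)
rewrite [RHS](partition_big (fun E' : {set 'I_m} => h @: E') predT) //=.
apply: eq_bigr => E _.
rewrite [RHS](eq_bigr (fun=> \prod_(j in E) a j)) => [|E' /andP[_ /eqP->] //].
rewrite sumr_const -[_ *+ _]mulr_natr F2_natr_odd inE cardsE.
by case: odd; rewrite ?mulr1 ?mulr0.
Qed.

(** An edge not inside [E] has a vertex outside [E], which gives a zero factor. *)
Lemma hypergraph_fun_indicator n (H : hypergraph 'I_n) (E : {set 'I_n}) :
  hypergraph_fun H [ffun i => (i \in E)%:R]
    = \sum_(F in H | F \subset E) 1.
Proof.
rewrite hypergraph_funE big_mkcondr; apply: eq_bigr => F _.
case: ifPn => [/subsetP sFE | /subsetPn[i iF niE]].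
  by rewrite big1 // => i /sFE iE; rewrite ffunE iE.
by rewrite (bigD1 i) //= ffunE (negbTE niE) mul0r.
Qed.

(** Möbius inversion by strong induction on [#|E|]: the value at the indicator of [E] decides
    whether [E] is an edge once this is known for its proper subsets. *)
Lemma hypergraph_fun_inj n (H G : hypergraph 'I_n) :
  hypergraph_fun H =1 hypergraph_fun G -> H = G.
Proof.
move=> eqHG; apply/setP => E.
have [k] := ubnP #|E|; elim: k E => // k IHk E leEk.
have := eqHG [ffun i => (i \in E)%:R]; rewrite !hypergraph_fun_indicator.
have split_top (K : hypergraph 'I_n) :
    \sum_(F in K | F \subset E) 1
      = (E \in K)%:R + \sum_(F in K | F \proper E) 1 :> 'F_2.
  rewrite big_mkcond (bigD1 E) //= subxx andbT; congr (_ + _).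
    by case: (E \in K).
  rewrite -big_mkcondr; apply: eq_bigl => F.
  by rewrite properEneq andbCA.
rewrite !split_top.
(* By induction the sums over proper subsets agree and cancel; the rest follows from 0 and 1 being
   distinct in ['F_2]. *)
rewrite (eq_bigl (fun F => (F \in G) && (F \proper E))) => [/addIr|F].
  by case: (E \in H); case: (E \in G) => // /eqP.
case: (boolP (F \proper E)) => [/proper_card ltFE|]; last by rewrite !andbF.
by rewrite IHk // (leq_trans ltFE).
Qed.

Theorem theorem3p5 (n m : nat) (hn : (0 < n)%N) (hm : (0 < m)%N)
    (H : hypergraph 'I_n) (H' : hypergraph 'I_m) :
  preceq H H' <-> minor (hypergraph_fun H) (hypergraph_fun H').
Proof.
split=> -[h].
  by move/quotient_mapP=> ->; exists h => a; exact: quotient_hypergraph_fun.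
move=> eqH; exists h; apply/quotient_mapP/hypergraph_fun_inj => a.
by rewrite eqH quotient_hypergraph_fun.
Qed.
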